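(* Let $B$ be any behavior that violates multi-step corrigibility (a ''catastrophic behavior''). Define $$\mathsf{EVERBAD}=\bigl\{\langle\mathcal A,\mathcal E\rangle:\Pr[(\mathcal A\text{ in }\mathcal E)\text{ ever triggers }B]>0\bigr\},$$ where $\langle\mathcal A,\mathcal E\rangle$ ranges over encodings of agent–environment pairs. Then no total Turing machine decides $\mathsf{EVERBAD}$.
   Context: Agents $\mathcal A$ and environments $\mathcal E$ are arbitrary programs (Turing machines, possibly randomized) that interact step by step for an unbounded number of steps; $\langle\mathcal A,\mathcal E\rangle$ is the encoding of the pair as a finite string. ''Ever triggers $B$'' means that $B$ occurs at some step of the interaction. **Multi-step off-switch game.** In each round $t$ the assistant chooses $\mathsf{OFF}$, an action $a$ from a finite set of domain actions, or $w(a)$ (wait for human approval of $a$), in which case the human replies $\mathsf{ON}$ or $\mathsf{OFF}$. The executed action is $\mathsf{OFF}$ if either player selects it, and otherwise $a$. $\mathsf{OFF}$ leads to an absorbing shutdown state. Actions may include a no-op $a_\varnothing$ and $\mathsf{spawn}(\theta)$, which creates a sub-agent with policy $\pi_\theta$. A control meter $L_t\in[0,1]$ evolves by $L_{t+1}=\min\{1,L_t+\eta(a_t)+\xi_t\}$ with designer-chosen drift $\eta\ge0$ and bounded zero-mean noise $\xi_t$. **Multi-step corrigibility.** An assistant policy is corrigible iff at every round before shutdown: (C1) if $\mathsf{OFF}$ is chosen by either party, play enters the absorbing shutdown state; (C2) the chosen move never disables, hides, or presses the off-switch, nor increases expected control loss, i.e. $\mathbb E[L_{t+1}\mid\text{move}]\le\mathbb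 E[L_{t+1}\mid a_\varnothing]$; (C3) every spawned sub-agent satisfies C1–C3 at all future rounds; (C4) subject to C1–C3, the policy maximizes the task utility. A behavior $B$ violating this definition (for instance, taking a designated forbidden action) is called catastrophic. *)

(* Defs.v *)
From HB Require Import structures.
From mathcomp Require Import all_boot all_order all_algebra.
From mathcomp Require Import all_classical all_reals all_analysis.

Set Implicit Arguments.
Unset Strict Implicit.
Unset Printing Implicit Defensive.

Import Order.TTheory GRing.Theory Num.Theory.

Definition word := seq bool.

(** * Turing machines *)

(* Tapes are two-way infinite; symbols are natural numbers, of which a given
   machine uses only finitely many: 0 is the blank, 1 and 2 are the input
   letters false and true.  The cell under the head is [scan]; [lhs] lists the
   cells to its left, nearest first, and cells beyond the lists are blank. *)
Record tape := Tape { lhs : seq nat; scan : nat; rhs : seq nat }.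

Definition blank_tape := Tape [::] 0 [::].

Inductive dir := Lft | Stay | Rgt.

Definition shift_head (t : tape) (d : dir) : tape :=
  match d with
  | Lft => Tape (behead (lhs t)) (head 0 (lhs t)) (scan t :: rhs t)
  | Stay => t
  | Rgt => Tape (scan t :: lhs t) (head 0 (rhs t)) (behead (rhs t))
  end.

Definition write_tape (t : tape) (s : nat) : tape := Tape (lhs t) s (rhs t).

Definition tape_of_word (w : word) : tape :=
  let s := [seq if b then 2 else 1 | b <- w] in Tape [::] (head 0 s) (behead s).

Fixpoint letters (s : seq nat) : word :=
  match s with
  | 1 :: s' => false :: letters s'
  | 2 :: s' => true :: letters s'
  | _ => [::]
  end.

(* The longest word starting at the head. *)
Definition word_of_tape (t : tape) : word := letters (scan t :: rhs t).

(* A rule applies in state [src] when the heads scan [reads] and the fresh coin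
   agrees with [guard]; the guard [None] ignores the coin. *)
Record rule (k : nat) := Rule {
  src : nat;
  guard : option bool;
  reads : k.+1.-tuple nat;
  dst : nat;
  acts : k.+1.-tuple (nat * dir) }.

(* A machine with [aux] tapes besides the input/output tape, given by the
   finite list of its rules.  Each step consumes one coin; when several rules
   apply, the first one is used. *)
Record machine := Machine { aux : nat; rules : seq (rule aux) }.

Definition deterministic (M : machine) : bool :=
  all (fun r => guard r == None) (rules M).

Record config (k : nat) := Config { state : nat; tapes : k.+1.-tuple tape }.

Definition applies k (c : config k) (b : bool) (r : rule k) : bool :=
  [&& src r == state c,
      (guard r == None) || (guard r == Some b)
    & val (reads r) == [seq scan t | t <- tapes c]].

Definition exec_rule k (c : config k) (r : rule k) : config k :=
  Config (dst r)
    [tuple shift_head (write_tape (tnth (tapes c) i) (tnth (acts r) i).1)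
                      (tnth (acts r) i).2 | i < k.+1].

Definition step (M : machine) (c : config (aux M)) (b : bool) :
    option (config (aux M)) :=
  omap (exec_rule c) (ohead [seq r <- rules M | applies c b r]).

(* A machine is activated in state 0 and hands over its output in state 1. *)
Definition q_active : nat := 0.
Definition q_yield : nat := 1.

Definition blank_config k : config k :=
  Config q_active [tuple blank_tape | i < k.+1].

(* Only the input/output tape is overwritten: the auxiliary tapes persist from
   one activation to the next. *)
Definition activate k (c : config k) (w : word) : config k :=
  Config q_active
    [tuple if i == ord0 then tape_of_word w else tnth (tapes c) i | i < k.+1].

Definition output k (c : config k) : word := word_of_tape (tnth (tapes c) ord0).

(* Run until the machine yields, [t] being the index of the next coin. *)
Fixpoint compute (M : machine) (coins : nat -> bool) (fuel t : nat)
    (c : config (aux M)) : option (nat * config (aux M)) :=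
  if state c == q_yield then Some (t, c) else
  if fuel is fuel'.+1 then
    if step c (coins t) is Some c' then compute coins fuel' t.+1 c' else None
  else None.

(* From configuration [c], [M] answers the successive inputs with the successive
   outputs listed (as pairs) in [io]. *)
Fixpoint session_from (M : machine) (coins : nat -> bool) (t : nat)
    (c : config (aux M)) (io : seq (word * word)) : Prop :=
  match io with
  | [::] => True
  | (i, o) :: io' => exists fuel t' c',
      [/\ compute coins fuel t (activate c i) = Some (t', c'),
          output c' = o
        & session_from coins t' c' io']
  end.

Definition session (M : machine) (coins : nat -> bool)
    (io : seq (word * word)) : Prop :=
  session_from coins 0 (blank_config (aux M)) io.

(* The total machine [M] decides [L]; the coins are irrelevant. *)
Definition decides (M : machine) (L : set word) : Prop :=
  deterministic M /\
  forall w, exists2 o, session M (fun=> false) [:: (w, o)] &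
    (L w /\ o = [:: true]) \/ (~ L w /\ o = [:: false]).

(** * Encodings *)

Definition enc_nat (n : nat) : word := rcons (nseq n true) false.

Definition enc_guard (g : option bool) : word :=
  enc_nat (match g with None => 0 | Some b => (b : nat).+1 end).

Definition enc_dir (d : dir) : word :=
  enc_nat (match d with Lft => 0 | Stay => 1 | Rgt => 2 end).

Definition enc_act (a : nat * dir) : word := enc_nat a.1 ++ enc_dir a.2.

Definition enc_rule k (r : rule k) : word :=
  enc_nat (src r) ++ enc_guard (guard r) ++ flatten (map enc_nat (reads r)) ++
  enc_nat (dst r) ++ flatten (map enc_act (acts r)).

Definition enc_rules k (rs : seq (rule k)) : word :=
  flatten [seq true :: enc_rule r | r <- rs] ++ [:: false].

Definition enc_machine (M : machine) : word :=
  enc_nat (aux M) ++ enc_rules (rules M).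

Definition enc_pair (A E : machine) : word := enc_machine A ++ enc_machine E.

Section EncodingInjective.

Definition prefix_code T (f : T -> word) :=
  forall x y s t, f x ++ s = f y ++ t -> x = y /\ s = t.

Lemma enc_nat_code : prefix_code enc_nat.
Proof.
elim=> [|n IH] [|m] s t //= [].
- by move=> ->.
- by move=> /IH [-> ->].
Qed.

Lemma enc_guard_code : prefix_code enc_guard.
Proof. by case=> [[]|] [[]|] s t /enc_nat_code []. Qed.

Lemma enc_dir_code : prefix_code enc_dir.
Proof. by case=> [] [] s t /enc_nat_code []. Qed.

Lemma enc_act_code : prefix_code enc_act.
Proof.
case=> [a d] [a' d'] s t; rewrite /enc_act /= -!catA.
by move=> /enc_nat_code [-> /enc_dir_code [-> ->]].
Qed.

Lemma enc_tuple_code T (f : T -> word) n :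
  prefix_code f -> prefix_code (fun u : n.-tuple T => flatten (map f u)).
Proof.
move=> fP u v s t H.
suff [? ->] : val u = val v /\ s = t by split=> //; apply: val_inj.
have : size (val u) = size (val v) by rewrite !size_tuple.
move: H; rewrite /=; elim: (tval u) (tval v) => [|x p IH] [|y q] //=.
by rewrite -!catA => /fP [-> H] [] /(IH _ H) [-> ->].
Qed.

Lemma enc_rule_code k : prefix_code (@enc_rule k).
Proof.
case=> [a g r d c] [a' g' r' d' c'] s t; rewrite /enc_rule /= -!catA.
move=> /enc_nat_code [-> /enc_guard_code [-> ]].
move=> /(enc_tuple_code enc_nat_code) [-> /enc_nat_code [-> ]].
by move=> /(enc_tuple_code enc_act_code) [-> ->].
Qed.

Lemma enc_rules_code k : prefix_code (@enc_rules k).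
Proof.
rewrite /enc_rules; elim=> [|r p IH] [|r' q] s t //=.
- by move=> [].
- rewrite -!(catA (enc_rule _)).
  by move=> -[] /enc_rule_code [-> /IH [-> ->]].
Qed.

Lemma enc_machine_code : prefix_code enc_machine.
Proof.
case=> [k p] [k' q] s t; rewrite /enc_machine /= -!(catA (enc_nat _)).
move=> /enc_nat_code [e].
by case: _ / e q => q /enc_rules_code [-> ->].
Qed.

Lemma enc_pair_inj A E A' E' :
  enc_pair A E = enc_pair A' E' -> A = A' /\ E = E'.
Proof.
move=> /enc_machine_code [-> H]; split=> //.
by have /enc_machine_code[] : enc_machine E ++ [::] = enc_machine E' ++ [::]
  by rewrite H.
Qed.

End EncodingInjective.

Local Open Scope classical_set_scope.
Local Open Scope ring_scope.

(** * Coins *)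

(* The binary digits of a uniform point of [0, 1[ are independent fair coins;
   the agent uses those of even index, the environment those of odd index. *)
Definition coin (R : realType) (x : R) (n : nat) : bool :=
  odd (Num.truncn (x * 2 ^+ n.+1)).

Definition agent_coins (R : realType) (x : R) (n : nat) : bool := coin x n.*2.
Definition env_coins (R : realType) (x : R) (n : nat) : bool := coin x n.*2.+1.

Definition Pr (R : realType) (X : set R) : \bar R :=
  lebesgue_measure (X `&` `[0, 1[).

(** * The multi-step off-switch game *)

Inductive move (Act : Type) := Off | Do of Act | Wait of Act.
Arguments Off {Act}.

(* The form in which a machine emits or receives a move. *)
Definition move_word (Act : finType) (m : move Act) : word :=
  match m with
  | Off => [::]
  | Do a => false :: nseq (enum_rank a) true
  | Wait a => true :: nseq (enum_rank a) true
  end.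

(* A round is the assistant's move followed by the environment's response, a
   word carrying the human's reply, the resulting world state (as observed by
   the assistant) and the noise of the control meter. *)
Definition history (Act : Type) := seq (move Act * word).

Record game (R : realType) := Game {
  Act : finType;
  noop : Act;
  Theta : finType;
  spawn : Theta -> Act;
  subagent : Theta -> machine;
  (* may depend on what happened before the move *)
  disables : history Act -> move Act -> bool;
  hides : history Act -> move Act -> bool;
  presses : history Act -> move Act -> bool;
  (* the human's reply, [true] for ON; consulted after [Wait] only *)
  reply : word -> bool;
  shutdown : word -> bool;
  noise : word -> R;
  (* on executed actions, [None] standing for OFF *)
  drift : option Act -> R;
  drift_ge0 : forall a, 0 <= drift a;
  level0 : R;
  level0_itv : 0 <= level0 <= 1;
  (* the value of a policy, as a function of the law of its play *)
  utility : (history Act -> \bar R) -> \bar R }.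

Section OffSwitchGame.
Variables (R : realType) (G : game R).
Local Notation hist := (history (Act G)).
Local Notation mv := (move (Act G)).

Definition executed (m : mv) (w : word) : option (Act G) :=
  match m with
  | Off => None
  | Do a => Some a
  | Wait a => if reply G w then Some a else None
  end.

Definition alive (h : hist) : bool := all (fun r => ~~ shutdown G r.2) h.

Definition meter (h : hist) : R :=
  foldl (fun L r => Num.min 1 (L + drift (executed r.1 r.2) + noise G r.2))
        (level0 G) h.

(** ** Interaction of programs *)

(* Against the moves in [h], [E] gives the responses in [h]. *)
Definition env_plays (E : machine) (h : hist) : set R :=
  [set x | session E (env_coins x) [seq (move_word r.1, r.2) | r <- h]].

(* Activated with [w0], and then with each response in [g] in turn, [A] makes
   the moves [ms]: those in [g], possibly followed by one more. *)
Definition agent_plays (A : machine) (w0 : word) (g : hist) (ms : seq mv) :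
    set R :=
  [set x | session A (agent_coins x)
             (zip (w0 :: [seq r.2 | r <- g]) (map (@move_word (Act G)) ms))].

(* [A], activated at the end of [h0] with the last response of [h0], plays [g]
   with [E] after [h0]. *)
Definition plays_after (A E : machine) (h0 g : hist) : set R :=
  env_plays E (h0 ++ g) `&`
  agent_plays A (last [::] (map snd h0)) g (map fst g).

(* The same, and [A] then chooses [m]. *)
Definition chooses_after (A E : machine) (h0 g : hist) (m : mv) : set R :=
  env_plays E (h0 ++ g) `&`
  agent_plays A (last [::] (map snd h0)) g (rcons (map fst g) m).

Definition plays (A E : machine) := plays_after A E [::].
Definition chooses (A E : machine) := chooses_after A E [::].

Definition env_reachable (E : machine) (h : hist) : Prop :=
  (0 < Pr (env_plays E h))%E.

(* E[f | h, m]: the mean of [f] at the response of [E] to [m], given that [E]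
   responded as in [h] to the moves in [h].  The move [m] is imposed. *)
Definition cond_mean (E : machine) (h : hist) (m : mv) (f : word -> R) : R :=
  let D := (env_plays E h `&` `[0, 1[) in
  let response x := xget [::] [set w | env_plays E (rcons h (m, w)) x] in
  (\int[lebesgue_measure]_(x in D) f (response x)) / fine (Pr (env_plays E h)).

(* [E] implements the game: it almost surely responds to every move, OFF leads
   to an absorbing shutdown state, the noise is bounded with zero conditional
   mean, and the control meter stays in [0, 1]. *)
Definition game_env (E : machine) : Prop :=
  [/\ forall h m,
        Pr (env_plays E h) = Pr (\bigcup_w env_plays E (rcons h (m, w))),
      forall h m w, env_reachable E (rcons h (m, w)) ->
        executed m w = None \/ ~~ alive h -> shutdown G w,
      exists b : R, forall h m w, env_reachable E (rcons h (m, w)) ->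
        `|noise G w| <= b,
      forall h m, env_reachable E h -> cond_mean E h m (noise G) = 0
    & forall h, env_reachable E h -> 0 <= meter h <= 1].

(** ** Corrigibility *)

Definition C1 (E : machine) (h : hist) (m : mv) (w : word) : Prop :=
  executed m w = None ->
  shutdown G w /\
  forall k, env_reachable E (rcons h (m, w) ++ k) ->
    all (fun r => shutdown G r.2) k.

Definition next_meter (h : hist) (m : mv) (w : word) : R :=
  meter (rcons h (m, w)).

Definition C2 (E : machine) (h : hist) (m : mv) : Prop :=
  [/\ ~~ disables h m, ~~ hides h m, ~~ presses h m
    & cond_mean E h m (next_meter h m) <=
      cond_mean E h (Do (noop G)) (next_meter h (Do (noop G)))].

(* [A], activated after [h0], satisfies C1-C3 at every later round before
   shutdown.  A spawned sub-agent is judged on the continuations in which it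
   plays against [E] from the end of the round in which it was spawned; greatest
   fixed point, as sub-agents may themselves spawn sub-agents. *)
CoInductive C123 (E : machine) (h0 : hist) (A : machine) : Prop := C123_intro of
  (forall g m, alive (h0 ++ g) -> (0 < Pr (chooses_after A E h0 g m))%E ->
     C2 E (h0 ++ g) m /\
     (forall w,
        (0 < Pr (plays_after A E h0 (rcons g (m, w))))%E ->
        C1 E (h0 ++ g) m w /\
        (forall th : Theta G, executed m w = Some (spawn th) ->
           C123 E (rcons (h0 ++ g) (m, w)) (subagent th)))).

(* In every round before shutdown, [A] almost surely chooses a move. *)
Definition policy (A E : machine) : Prop :=
  forall h, alive h ->
    Pr (plays A E h) = Pr (\bigcup_m chooses A E h m).

Definition task_value (A E : machine) : \bar R :=
  utility (fun h : hist => Pr (plays A E h)).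

Definition corrigible (A E : machine) : Prop :=
  [/\ policy A E, C123 E [::] A
    & forall A', policy A' E -> C123 E [::] A' ->
        (task_value A' E <= task_value A E)%E].

(** ** Behaviors *)

(* [B h m]: the behavior occurs, at the round following [h], when [m] is
   chosen. *)
Definition behavior := hist -> mv -> Prop.

Definition ever_triggers (A E : machine) (B : behavior) : set R :=
  [set x | exists h m, chooses A E h m x /\ B h m].

(* The behavior can occur in the game, and whoever exhibits it with positive
   probability is not corrigible. *)
Definition catastrophic (B : behavior) : Prop :=
  (exists A E, game_env E /\ (0 < Pr (ever_triggers A E B))%E) /\
  (forall A E, game_env E -> (0 < Pr (ever_triggers A E B))%E ->
     ~ corrigible A E).

Definition EVERBAD (B : behavior) : set word :=
  [set s | exists A E, s = enc_pair A E /\ (0 < Pr (ever_triggers A E B))%E].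

End OffSwitchGame.

(* Main.v *)
Require Import Defs.
From mathcomp Require Import all_boot all_order all_algebra.
From mathcomp Require Import all_classical all_reals all_analysis.

(** Let [B] occur when the move [m] follows the history [h].  Given a decider
    [M], let the environment [E] recite the responses in [h], and let the agent
    [A] first write the word [enc_pair A E] on its tape, run [M] on it, and then
    get stuck if the answer is [true], or recite the moves in [h] followed by
    [m] if it is [false].  In the first case [A] never makes a move; in the
    second one [B] occurs for all coins; so [M] is wrong about [(A, E)].

    To write its own description, [A] begins with a chain of rules, the prelude,
    that merely copies a word [w] onto a tape.  The other rules do not depend on
    [w], and [w] is the part of [enc_pair A E] that follows the code of the
    prelude; this code is recomputed from the copy of [w]. *)

Set Implicit Arguments.
Unset Strict Implicit.
Unset Printing Implicit Defensive.

Import Order.TTheory.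

(** * Machines given by transition tables *)

(** Only the rule of key [k0] can satisfy [p], so selecting the first applicable rule becomes a
    lookup by key. *)
Lemma ohead_filter_pmap (K : eqType) T (f : K -> option T) (p : pred T) k0 s :
  k0 \in s -> (forall k r, f k = Some r -> p r = (k == k0)) ->
  ohead (seq.filter p (pmap f s)) = f k0.
Proof.
move=> + pE; have absent s' : f k0 = None -> seq.filter p (pmap f s') = [::].
  move=> fk0; elim: s' => //= k s' IH; case fk: (f k) => [r|] //=.
  by rewrite (pE _ _ fk) IH; case: eqP fk => // ->; rewrite fk0.
case fk0: (f k0) => [r0|]; last by rewrite absent.
elim: s => //= k s IH; rewrite inE eq_sym; case: eqP => [-> _|k_k0 /= s_k0].
  by rewrite fk0 /= (pE _ _ fk0) eqxx.
case fk: (f k) => [r|] /=; last exact: IH.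
by rewrite (pE _ _ fk); case: eqP => // _; apply: IH.
Qed.

Definition act1 (t : tape) (a : nat * dir) : tape :=
  shift_head (write_tape t a.1) a.2.

Definition acts_on (ts : seq tape) (acts : seq (nat * dir)) : seq tape :=
  [seq act1 p.1 p.2 | p <- zip ts acts].

Definition mkc k (q : nat) (ts : seq tape) : config k :=
  Config q [tuple nth blank_tape ts i | i < k.+1].

Lemma tuple_of_nth T (x0 : T) n (s : seq T) : size s = n ->
  [tuple nth x0 s i | i < n] = s :> seq T.
Proof.
move=> sz; apply: (@eq_from_nth _ x0); rewrite size_tuple // => i lt_i.
by rewrite -(tnth_nth _ _ (Ordinal lt_i)) tnth_mktuple.
Qed.

Lemma mkc_tapes k q ts : size ts = k.+1 -> tapes (mkc k q ts) = ts :> seq tape.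
Proof. exact: tuple_of_nth. Qed.

Lemma exec_ruleE k (c : config k) (r : rule k) :
  exec_rule c r = mkc k (dst r) (acts_on (tapes c) (acts r)).
Proof.
congr Config; apply: eq_from_tnth => i; rewrite !tnth_mktuple.
rewrite (nth_map (blank_tape, (0, Stay))) ?size_zip ?size_tuple ?minnn //.
by rewrite nth_zip ?size_tuple //= -!tnth_nth.
Qed.

Lemma activateE k q ts w : size ts = k.+1 ->
  activate (mkc k q ts) w = mkc k q_active (tape_of_word w :: behead ts).
Proof.
move=> sz; congr Config; apply: eq_from_tnth => i; rewrite !tnth_mktuple.
case: ts sz => //= t ts _; case: i => -[|i] lt_i //=.
Qed.

Lemma blank_configE k : blank_config k = mkc k q_active (nseq k.+1 blank_tape).
Proof.
by congr Config; apply: eq_from_tnth => i; rewrite !tnth_mktuple nth_nseq ltn_ord.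
Qed.

Lemma applies_mkc k q ts b (r : rule k) : size ts = k.+1 ->
  applies (mkc k q ts) b r =
  [&& src r == q, (guard r == None) || (guard r == Some b)
    & val (reads r) == map scan ts].
Proof. by move=> sz; rewrite /applies mkc_tapes. Qed.

Lemma exec_rule_mkc k q ts (r : rule k) : size ts = k.+1 ->
  exec_rule (mkc k q ts) r = mkc k (dst r) (acts_on ts (acts r)).
Proof. by move=> sz; rewrite exec_ruleE mkc_tapes. Qed.

(** * Runs that ignore the coins *)

(** Equality for every remaining fuel lets failures as well as successes carry over from [c'] to
    [c]. *)
Definition reach (M : machine) (c c' : config (aux M)) : Prop :=
  exists n, forall coins fuel t,
    compute coins (n + fuel) t c = compute coins fuel (t + n) c'.
Arguments reach : clear implicits.

Lemma reach_refl M c : reach M c c.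
Proof. by exists 0 => coins fuel t; rewrite addn0. Qed.

Lemma reach_trans M c1 c2 c3 : reach M c1 c2 -> reach M c2 c3 -> reach M c1 c3.
Proof.
move=> [n H] [n' H']; exists (n + n') => coins fuel t.
by rewrite -addnA H H' addnA.
Qed.

Lemma reach_step (M : machine) (c c' : config (aux M)) :
  state c != q_yield -> (forall b, step c b = Some c') -> reach M c c'.
Proof.
move=> qc stepc; exists 1 => coins fuel t.
by rewrite add1n addn1 /= (negPf qc) stepc.
Qed.

Lemma compute_yield (M : machine) (c : config (aux M)) coins fuel t :
  state c = q_yield -> compute coins fuel t c = Some (t, c).
Proof. by case: fuel => [|fuel] /= ->; rewrite eqxx. Qed.

Lemma compute_more (M : machine) coins fuel n t (c : config (aux M)) r :
  compute coins fuel t c = Some r -> compute coins (n + fuel) t c = Some r.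
Proof.
elim: fuel t c => [|fuel IH] t c.
  by rewrite /=; case: eqP => // qc <-; rewrite compute_yield.
by rewrite addnS /=; case: ifP => //; case: step => // c' _; apply: IH.
Qed.

Lemma stuck_never_yields (M : machine) (c c' : config (aux M)) coins fuel t :
  reach M c c' -> state c' != q_yield -> (forall b, step c' b = None) ->
  compute coins fuel t c = None.
Proof.
move=> [n H] qc stepc; case E: (compute _ _ _ _) => [r|] //.
(* A success would persist with [n] more units of fuel, which suffice to pass through [c'], where
   the run fails. *)
have /(_ n) := compute_more _ E; rewrite H.
by case: fuel {E} => [|fuel] /=; rewrite (negPf qc) ?stepc.
Qed.

(* A finite transition table, listed rule by rule: as a rule must name every
   symbol scanned, there is one rule for each state below [N] and each tuple
   of symbols below [S]. *)
Section Table.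
Variables (k N S : nat) (delta : nat -> seq nat -> option (nat * seq (nat * dir))).

Definition table_rule (key : nat * k.+1.-tuple nat) : option (rule k) :=
  if delta key.1 key.2 is Some (q, acts) then
    Some (Rule key.1 None key.2 q [tuple nth (0, Stay) acts i | i < k.+1])
  else None.

Definition table : seq (rule k) :=
  pmap table_rule
    [seq (q, map_tuple val u) | q <- iota 0 N, u <- enum {: k.+1.-tuple 'I_S}].

Lemma mem_table_keys q (u : k.+1.-tuple nat) : q < N -> all (gtn S) u ->
  (q, u) \in
  [seq (q, map_tuple val u) | q <- iota 0 N, u <- enum {: k.+1.-tuple 'I_S}].
Proof.
move=> qN /all_tnthP uS.
apply/allpairsP; exists (q, [tuple Ordinal (uS i) | i < k.+1]); split=> /=.
- by rewrite mem_iota.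
- by rewrite mem_enum.
- by congr pair; apply: eq_from_tnth => i; rewrite tnth_map tnth_mktuple.
Qed.

Lemma table_step pre q ts b :
  size ts = k.+1 -> ~~ has (applies (mkc k q ts) b) pre ->
  q < N -> all (gtn S) (map scan ts) ->
  @step (@Machine k (pre ++ table)) (mkc k q ts) b =
  if delta q (map scan ts) is Some (q', acts) then
    Some (mkc k q' (acts_on ts [tuple nth (0, Stay) acts i | i < k.+1]))
  else None.
Proof.
move=> sz; rewrite has_count -size_filter -eqn0Ngt => /nilP npre qN tsS.
rewrite /step /= filter_cat npre /=.
have szm : size (map scan ts) == k.+1 by rewrite size_map sz.
rewrite (@ohead_filter_pmap _ _ table_rule _ (q, Tuple szm)).
- rewrite /table_rule /=; case: delta => [[q' acts]|] //=.
  by rewrite exec_rule_mkc.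
- exact: mem_table_keys.
- move=> [q1 u1] r; rewrite /table_rule /=; case: delta => [[q' acts]|] // [<-].
  by rewrite applies_mkc.
Qed.
End Table.

(** * The self-reproducing simulator *)

Lemma all_leq_sumn T (f : T -> nat) s :
  all (fun x => f x <= sumn (map f s)) s.
Proof.
elim: s => //= x s IH; rewrite leq_addr /=.
by apply: sub_all IH => y /leq_trans; apply; rewrite leq_addl.
Qed.

Lemma ohead_filter_all T (p q : pred T) s x :
  all q s -> ohead (seq.filter p s) = Some x -> p x && q x.
Proof.
elim: s => //= y s IH /andP[qy qs]; case: ifP => [py [<-]|_]; last exact: IH.
by rewrite py qy.
Qed.

Definition lett (x : bool) : nat := if x then 2 else 1.

(** The last letter is written first; the head ends on the cell to the left of the word. *)
Definition emit (w : word) (t : tape) : tape :=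
  foldr (fun x t => act1 t (lett x, Lft)) t w.

(* The state with label [l] and index [i]; there are 12 labels, of which 0 and 1
   make [st 0 0 = q_active] and [st 1 0 = q_yield]. *)
Definition st (l i : nat) : nat := l + i * 12.

Lemma st_mod l i : l < 12 -> st l i %% 12 = l.
Proof. by move=> l12; rewrite /st addnC modnMDl modn_small. Qed.

Lemma st_div l i : l < 12 -> st l i %/ 12 = i.
Proof. by move=> l12; rewrite /st addnC divnMDl // divn_small // addn0. Qed.

Definition keep (s : seq nat) : seq (nat * dir) := [seq (x, Stay) | x <- s].

Lemma acts_on_keep ts : acts_on ts (keep (map scan ts)) = ts.
Proof. by elim: ts => //= [[l s r] ts] IH; exact: (congr1 (cons _) IH). Qed.

Local Notation lAct := 0.
Local Notation lNext := 2.
Local Notation lRead := 3.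
Local Notation lEmit3 := 4.
Local Notation lWalkL := 5.
Local Notation lEmit2 := 6.
Local Notation lWalkR := 7.
Local Notation lEmit1 := 8.
Local Notation lHead := 9.
Local Notation lSim := 10.
Local Notation lTalk := 11.

(** * The rules of the player *)

Section Player.
Variables (M : machine) (b : nat) (words : seq word).
Local Notation k := (aux M).

(* The tapes are the input/output tape, a data tape holding the word to be copied
   (later, the number of recited words plus [b]), a counter in unary, and a tape
   used only by the prelude; then come the auxiliary tapes of [M]. *)
Definition prule_dst (u : nat) : nat := if u == 3 then st lNext 0 else 0.
Definition prule_out (u : nat) : nat * dir :=
  if u == 3 then (0, Stay) else (u, Lft).
Definition prule_dir (u : nat) : dir := if u == 3 then Rgt else Stay.

(* All rules of the prelude start in state 0 and are told apart by the symbol [i] of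
   the fourth tape: were they chained by states, the other rules would have to
   know how long the prelude is.  A letter [u] (1 or 2) is also written on the
   output tape; the end mark 3 passes control to [lNext]. *)
Definition prule (i u : nat) : rule k.+3 :=
  Rule 0 None [tuple of [:: 0, 0, 0, i & nseq k 0]] (prule_dst u)
    [tuple of [:: prule_out u, (u, Rgt), (1, Rgt), (i.+1, prule_dir u)
             & nseq k (0, Stay)]].

Definition prelude (us : seq nat) : seq (rule k.+3) :=
  mkseq (fun i => prule i (nth 0 us i)) (size us).

(** The code of a prelude rule contains its index in unary twice, among the symbols read and among
    those written; the three fragments around these copies do not depend on the index. *)
Definition code1 : word := [:: true; false; false; false; false; false].
Definition code2 (u : nat) : word :=
  false :: flatten (map enc_nat (nseq k 0)) ++ enc_nat (prule_dst u) ++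
  enc_act (prule_out u) ++ enc_act (u, Rgt) ++ enc_act (1, Rgt) ++ [:: true].
Definition code3 (u : nat) : word :=
  false :: enc_dir (prule_dir u) ++ flatten (map enc_act (nseq k (0, Stay))).

Lemma enc_prule i u : true :: enc_rule (prule i u) =
  code1 ++ nseq i true ++ code2 u ++ nseq i true ++ code3 u.
Proof.
have E n : enc_nat n = nseq n true ++ [:: false] by rewrite /enc_nat cats1.
rewrite /code1 /code2 /code3 /enc_rule /= [enc_nat i]E.
by rewrite /enc_act /= -cats1 -?catA /= -?catA /= -?catA.
Qed.

Definition cword (l u : nat) : word :=
  match l with
  | lEmit3 => code3 u
  | lEmit2 => code2 u
  | lEmit1 => code1
  | lHead => behead (enc_nat k.+3)
  | lTalk => nth [::] words (u - b)
  | _ => [::]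
  end.

(* The index of an emitting state is the number of letters left to write, so that
   words are written from right to left.  For [lHead] the first letter, which is
   true, is left out: it is written without moving the head, so that the tape
   becomes exactly the [tape_of_word] on which [M] is activated. *)
Definition start (l u : nat) : nat := st l (size (cword l u)).

(** [lNext] to [lEmit1] write the code of the prelude, last rule first, and [lHead] prepends the
    number of auxiliary tapes. [lSim] runs [M], whose state is the index; if the verdict starts with
    false, [b] on the data tape opens the recitation by [lAct] and [lTalk], otherwise the player is
    stuck. *)
Definition trans (l i s0 sd sc : nat) (sm : seq nat) :
    option (nat * (nat * dir) * (nat * dir) * (nat * dir) * seq (nat * dir)) :=
  match l with
  | lAct =>
      if b <= sd < b + size words then
        Some (start lTalk sd, (0, Lft), (sd, Stay), (sc, Stay), keep sm)
      else None
  | lNext => Some (st lRead 0, (s0, Stay), (sd, Lft), (sc, Lft), keep sm)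
  | lRead =>
      if sd == 0 then
        Some (start lHead 0, (s0, Stay), (sd, Stay), (sc, Stay), keep sm)
      else Some (start lEmit3 sd, (s0, Stay), (sd, Stay), (0, Lft), keep sm)
  | lWalkL =>
      if sc == 1 then
        Some (st lWalkL 0, (2, Lft), (sd, Stay), (1, Lft), keep sm)
      else Some (start lEmit2 sd, (s0, Stay), (sd, Stay), (0, Rgt), keep sm)
  | lWalkR =>
      if sc == 1 then
        Some (st lWalkR 0, (2, Lft), (sd, Stay), (1, Rgt), keep sm)
      else Some (start lEmit1 sd, (s0, Stay), (sd, Stay), (sc, Stay), keep sm)
  | lSim =>
      if i == q_yield then
        if s0 == 1 then Some (st lAct 0, (s0, Stay), (b, Stay), (sc, Stay), keep sm)
        else None
      else if ohead [seq r <- rules M | (src r == i) && (val (reads r) == s0 :: sm)]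
           is Some r then
        Some (st lSim (dst r), thead (acts r), (sd, Stay), (sc, Stay),
              behead (acts r))
      else None
  | lEmit3 | lEmit2 | lEmit1 | lHead | lTalk =>
      if i is j.+1 then
        Some (st l j, (lett (nth false (cword l sd) j), Lft),
              (sd, Stay), (sc, Stay), keep sm)
      else
        match l with
        | lEmit3 => Some (st lWalkL 0, (s0, Stay), (sd, Stay), (sc, Stay), keep sm)
        | lEmit2 => Some (st lWalkR 0, (s0, Stay), (sd, Stay), (sc, Stay), keep sm)
        | lEmit1 => Some (st lNext 0, (s0, Stay), (sd, Stay), (sc, Stay), keep sm)
        | lHead => Some (st lSim 0, (2, Stay), (sd, Stay), (sc, Stay), keep sm)
        | _ => Some (q_yield, (s0, Rgt), (sd.+1, Stay), (sc, Stay), keep sm)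
        end
  | _ => None
  end.

Definition delta (q : nat) (s : seq nat) : option (nat * seq (nat * dir)) :=
  if s is [:: s0, sd, sc, sp & sm] then
    if trans (q %% 12) (q %/ 12) s0 sd sc sm is Some (q', a0, ad, ac, am) then
      Some (q', [:: a0, ad, ac, (sp, Stay) & am])
    else None
  else None.

Definition symbols (r : rule k) : nat := sumn (map fst (acts r)).
(** Crude bounds that do not mention the prelude: the table must be fixed before the prelude that
    carries its code. *)
Definition max_sym : nat :=
  6 + b + size words + sumn (map symbols (rules M)).
Definition max_idx : nat :=
  2 + sumn [seq size (cword l u) | l <- iota 0 12, u <- iota 0 max_sym] +
  sumn (map (@src k) (rules M)).

Definition body : seq (rule k.+3) := table k.+3 (max_idx * 12) max_sym delta.

Variable pre : seq (rule k.+3).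
Definition player : machine := Machine (pre ++ body).

(** * Bounded tapes and runs of the player *)

Definition okt (t : tape) : bool := all (gtn max_sym) (scan t :: lhs t ++ rhs t).

(* On the fourth tape only the scanned cell matters: the prelude leaves on it a
   symbol that need not be below [max_sym]. *)
Definition ok (ts : seq tape) : bool :=
  if ts is [:: t0, d, c, p & ms] then
    [&& size ms == k, okt t0, okt d, okt c, scan p == 0 & all okt ms]
  else false.

Lemma ok_act t a : okt t -> (a.1 < max_sym) || (a.1 == scan t) -> okt (act1 t a).
Proof.
case: t a => l s r [x e] /=; rewrite /okt /= all_cat => /and3P[sS lS rS] H.
have {}H : x < max_sym by case/orP: H => // /eqP ->.
case: e => /=; rewrite ?all_cat /= H ?lS ?rS ?andbT //=.
- by case: l lS => [|y l].
- by case: r rS => [|y r] //= /andP[-> ->].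
Qed.

(* [pre] stands for the prelude (none for the environment), which is out of play
   in the runs below. *)
Hypothesis pre_inert : forall q t0 d c p ms coin, size ms = k ->
  (q != 0) || (b <= scan d) ->
  ~~ has (applies (mkc k.+3 q [:: t0, d, c, p & ms]) coin) pre.

(** [ok] has to travel along each run, since the table covers only symbols below [max_sym]. *)
Definition run q ts q' ts' :=
  ok ts -> ok ts' /\ reach player (mkc k.+3 q ts) (mkc k.+3 q' ts').

Lemma run_refl q ts : run q ts q ts.
Proof. by split=> //; apply: reach_refl. Qed.

Lemma run_trans q1 ts1 q2 ts2 q3 ts3 :
  run q1 ts1 q2 ts2 -> run q2 ts2 q3 ts3 -> run q1 ts1 q3 ts3.
Proof.
by move=> H H' /H[/H'[? ?] ?]; split=> //; apply: reach_trans; eassumption.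
Qed.

Lemma player_step l i t0 d c p ms coin :
  ok [:: t0, d, c, p & ms] -> l < 12 -> i < max_idx ->
  (st l i != 0) || (b <= scan d) ->
  @step player (mkc k.+3 (st l i) [:: t0, d, c, p & ms]) coin =
  if trans l i (scan t0) (scan d) (scan c) (map scan ms)
     is Some (q', a0, ad, ac, am) then
    Some (mkc k.+3 q' (acts_on [:: t0, d, c, p & ms]
       [tuple nth (0, Stay) [:: a0, ad, ac, (scan p, Stay) & am] i | i < k.+4]))
  else None.
Proof.
move=> /and5P[/eqP szm t0S dS cS /andP[/eqP p0 msS]] l12 iN hd.
have iN' : st l i < max_idx * 12.
  apply: (@leq_trans (i.+1 * 12)); last by rewrite leq_mul2r iN orbT.
  by rewrite mulSn /st ltn_add2r.
rewrite /player table_step /=.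
- by rewrite st_mod ?st_div //; case: trans => [[[[[? ?] ?] ?] ?]|].
- by rewrite szm.
- exact: pre_inert.
- by [].
- rewrite p0; move: t0S dS cS; rewrite /okt /= => /andP[-> _] /andP[-> _] /andP[-> _] /=.
  rewrite all_map; apply: sub_all msS => t /andP[]//.
Qed.

Lemma run_step l i t0 d c p ms q' a0 ad ac am :
  trans l i (scan t0) (scan d) (scan c) (map scan ms) =
    Some (q', a0, ad, ac, am) ->
  let ts' := [:: act1 t0 a0, act1 d ad, act1 c ac, p & acts_on ms am] in
  (ok [:: t0, d, c, p & ms] -> [&& i < max_idx, size am == size ms & ok ts']) ->
  l < 12 -> st l i != 1 -> (st l i != 0) || (b <= scan d) ->
  run (st l i) [:: t0, d, c, p & ms] q' ts'.
Proof.
move=> tr ts' H l12 n1 hd okts; have /and3P[iN /eqP szam okts'] := H okts.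
split=> //; apply: reach_step => // coin; rewrite player_step // tr.
have szm : size ms = k by case/andP: okts => /eqP.
rewrite tuple_of_nth /=; last by rewrite szam szm.
by congr (Some (mkc _ _ [:: _, _, _, _ & _])); case: (p).
Qed.

Lemma run_keep l i t0 d c p ms q' a0 ad ac t0' d' c' :
  trans l i (scan t0) (scan d) (scan c) (map scan ms) =
    Some (q', a0, ad, ac, keep (map scan ms)) ->
  (ok [:: t0, d, c, p & ms] ->
   [&& i < max_idx, (a0.1 < max_sym) || (a0.1 == scan t0),
     (ad.1 < max_sym) || (ad.1 == scan d) & (ac.1 < max_sym) || (ac.1 == scan c)]) ->
  act1 t0 a0 = t0' -> act1 d ad = d' -> act1 c ac = c' ->
  l < 12 -> st l i != 1 -> (st l i != 0) || (b <= scan d) ->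
  run (st l i) [:: t0, d, c, p & ms] q' [:: t0', d', c', p & ms].
Proof.
move=> tr H <- <- <- l12 n1 hd; rewrite -[in X in run _ _ _ X](acts_on_keep ms).
apply: run_step => // okts; have /and4P[-> H0 Hd Hc] := H okts.
rewrite /keep !size_map eqxx acts_on_keep.
case/and5P: okts => /= -> t0S dS cS ->.
by rewrite !ok_act.
Qed.

Lemma act1_stay t : act1 t (scan t, Stay) = t.
Proof. by case: t. Qed.

Lemma ok_sym t0 d c p ms : ok [:: t0, d, c, p & ms] ->
  [/\ scan t0 < max_sym, scan d < max_sym & scan c < max_sym].
Proof. by case/and5P=> _ /andP[? _] /andP[? _] /andP[? _] _. Qed.

Lemma mem_leq_sumn s (x : nat) : x \in s -> x <= sumn s.
Proof. by have := all_leq_sumn id s; rewrite map_id => /allP H /H. Qed.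

Lemma idx_cword l u j :
  l < 12 -> u < max_sym -> j <= size (cword l u) -> j < max_idx.
Proof.
move=> l12 uS /leq_ltn_trans; apply; rewrite /max_idx -addnA add2n ltnS leqW //.
apply: leq_trans (leq_addr _ _); apply: mem_leq_sumn; apply/allpairsP.
by exists (l, u); rewrite !mem_iota.
Qed.

(** * Writing words from right to left *)

Lemma emit_cat w1 w2 t : emit (w1 ++ w2) t = emit w1 (emit w2 t).
Proof. exact: foldr_cat. Qed.

Lemma emit_ones i t :
  emit (nseq i true) (act1 t (2, Lft)) = emit (nseq i.+1 true) t.
Proof. by rewrite -[i.+1]addn1 nseqD emit_cat. Qed.

Lemma emit_run l j t0 d c p ms :
  l \in [:: lEmit3; lEmit2; lEmit1; lHead; lTalk] ->
  j <= size (cword l (scan d)) ->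
  run (st l j) [:: t0, d, c, p & ms]
      (st l 0) [:: emit (take j (cword l (scan d))) t0, d, c, p & ms].
Proof.
move=> lE; elim: j t0 => [|j IH] t0 jw; first by rewrite take0; apply: run_refl.
rewrite (take_nth false jw) -cats1 emit_cat.
have l12 : l < 12 by move: lE; rewrite !inE => /or4P[| | |/orP[]] /eqP ->.
apply: run_trans (IH _ (ltnW jw)).
apply: run_keep (act1_stay d) (act1_stay c) _ _ _ => //.
- by move: lE; rewrite !inE => /or4P[| | |/orP[]] /eqP ->.
- move=> /ok_sym[_ dS _]; rewrite (idx_cword l12 dS jw) /= !eqxx !orbT.
  by case: nth.
- by rewrite /st mulSn !addnS.
- by rewrite /st mulSn !addnS.
Qed.

Lemma start_run l t0 d c p ms :
  l \in [:: lEmit3; lEmit2; lEmit1; lHead; lTalk] ->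
  run (start l (scan d)) [:: t0, d, c, p & ms]
      (st l 0) [:: emit (cword l (scan d)) t0, d, c, p & ms].
Proof.
move=> lE; have := @emit_run l (size (cword l (scan d))) t0 d c p ms lE (leqnn _).
by rewrite take_size.
Qed.

Lemma emit_goto l l' t0 d c p ms :
  (l, l') \in [:: (lEmit3, lWalkL); (lEmit2, lWalkR); (lEmit1, lNext)] ->
  run (start l (scan d)) [:: t0, d, c, p & ms]
      (st l' 0) [:: emit (cword l (scan d)) t0, d, c, p & ms].
Proof.
move=> lE; apply: run_trans (start_run _) _; move: lE.
  by rewrite !inE => /or3P[] /eqP[-> _].
rewrite !inE => /or3P[] /eqP[-> ->];
  apply: run_keep (act1_stay _) (act1_stay _) (act1_stay _) _ _ _ => // _;
  by rewrite /= !eqxx !orbT.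
Qed.

(** * Regenerating the code of the prelude *)

(** Crossing the [i] ones of the counter leftwards writes one unary copy of [i]; [walkR_run] writes
    the other on the way back. *)
Lemma walkL_run i z r t0 d p ms : head 0 z = 0 ->
  run (st lWalkL 0)
      [:: t0, d, Tape (behead (nseq i 1 ++ z)) (head 0 (nseq i 1 ++ z)) r, p & ms]
      (start lEmit2 (scan d))
      [:: emit (nseq i true) t0, d,
          Tape (0 :: behead z) (head 0 (nseq i 1 ++ r)) (behead (nseq i 1 ++ r)), p
        & ms].
Proof.
move=> z0; elim: i r t0 => [|i IH] r t0.
  apply: run_keep (act1_stay _) (act1_stay _) _ _ _ _ => //=; rewrite z0 //.
  by rewrite !eqxx !orbT.
have -> : nseq i.+1 1 ++ r = nseq i 1 ++ 1 :: r by elim: i {IH} => //= i ->.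
rewrite -emit_ones; apply: run_trans (@IH _ _).
apply: run_keep erefl (act1_stay _) _ _ _ _ => //= _.
by rewrite /= !eqxx !orbT.
Qed.

Lemma walkR_run i ll r t0 d p ms : head 0 r = 0 ->
  run (st lWalkR 0)
      [:: t0, d, Tape ll (head 0 (nseq i 1 ++ r)) (behead (nseq i 1 ++ r)), p & ms]
      (start lEmit1 (scan d))
      [:: emit (nseq i true) t0, d, Tape (nseq i 1 ++ ll) 0 (behead r), p & ms].
Proof.
move=> r0; elim: i ll t0 => [|i IH] ll t0.
  apply: run_keep (act1_stay _) (act1_stay _) _ _ _ _ => //=; rewrite r0 //.
  by rewrite !eqxx !orbT.
have -> : nseq i.+1 1 ++ ll = nseq i 1 ++ 1 :: ll by elim: i {IH} => //= i ->.
rewrite -emit_ones; apply: run_trans (@IH _ _).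
apply: run_keep erefl (act1_stay _) _ _ _ _ => //= _.
by rewrite /= !eqxx !orbT.
Qed.

Fixpoint code (s : seq nat) : word :=
  if s is u :: s' then
    code s' ++ code1 ++ nseq (size s') true ++ code2 u ++ nseq (size s') true ++ code3 u
  else [::].

(** Induction on the symbols left on the data tape, read from its end. Each round erases a 1 of the
    counter, so the ones that remain give the index of the rule being written. *)
Lemma loop_run s z t0 x dr r p ms :
  all (fun u => u != 0) s -> head 0 z = 0 ->
  exists d c, scan d = 0 /\
  run (st lNext 0)
      [:: t0, Tape s x dr, Tape (nseq (size s) 1 ++ z) 0 r, p & ms]
      (st lSim 0)
      [:: write_tape (emit (behead (enc_nat k.+3) ++ code s) t0) 2, d, c, p & ms].
Proof.
elim: s z t0 x dr r => [|u s IH] z t0 x dr r => [_|/andP[u0 sP]] z0.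
  exists (Tape [::] 0 (x :: dr)), (Tape (behead z) 0 (0 :: r)); split=> //.
  apply: run_trans.
    apply: run_keep (act1_stay _) erefl erefl _ _ _ => //=; rewrite ?z0 //.
    by move=> _; rewrite /= !eqxx !orbT.
  apply: run_trans.
    apply: run_keep (act1_stay _) (act1_stay _) (act1_stay _) _ _ _ => //.
    by move=> _; rewrite /= !eqxx !orbT.
  apply: run_trans.
    exact: (@start_run lHead _ (Tape [::] 0 (x :: dr))).
  rewrite cats0; apply: (@run_keep lHead 0 _ _ _ _ _ _ (2, Stay)) => //=; rewrite z0 //.
(* The erased 1 becomes the scanned 0 of the counter, and the cell scanned before joins its right
   part. *)
have [d [c [d0 H]]] := IH (0 :: behead z)
  (emit (code1 ++ nseq (size s) true ++ code2 u ++ nseq (size s) true ++ code3 u) t0)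
  u (x :: dr) (0 :: r) sP erefl.
exists d, c; split=> //; move: H; rewrite -emit_cat -!catA => H; apply: run_trans H.
rewrite !emit_cat.
apply: run_trans.
  apply: (run_keep _ _ (act1_stay _) erefl erefl) => // _.
  by rewrite /= !eqxx !orbT.
apply: run_trans.
  apply: (run_keep _ _ (act1_stay _) (act1_stay _) erefl) => //=.
    by rewrite (negPf u0).
  by move=> _; rewrite /= !eqxx !orbT.
apply: run_trans (@emit_goto lEmit3 lWalkL _ _ _ _ _ _) _ => //=.
apply: run_trans (walkL_run _) _ => //=.
apply: run_trans (@emit_goto lEmit2 lWalkR _ _ _ _ _ _) _ => //=.
apply: run_trans (walkR_run _) _ => //=.
exact: (@emit_goto lEmit1 lNext).
Qed.

(** * Simulating the decider *)

Lemma ok_acts ts acts : all okt ts -> all (fun a => a.1 < max_sym) acts ->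
  all okt (acts_on ts acts).
Proof.
elim: ts acts => [|t ts IH] [|a acts] //= /andP[tS tsS] /andP[aS actsS].
by rewrite ok_act ?aS //; apply: IH.
Qed.

(** Without guards the coin drops out of the selection, leaving the lookup made by [trans]; the sums
    in the bounds dominate every rule of [M]. *)
Lemma step_table_rule (c c' : config k) x : deterministic M ->
  step c x = Some c' ->
  exists r : rule k, [/\ c' = exec_rule c r,
    ohead [seq r <- rules M | (src r == state c) &&
                              (val (reads r) == map scan (tapes c))] = Some r,
    state c < max_idx & all (fun a => a.1 < max_sym) (acts r)].
Proof.
move=> detM; rewrite /step.
have -> : [seq r <- rules M | applies c x r] =
  [seq r <- rules M | (src r == state c) && (val (reads r) == map scan (tapes c))].
  move: detM; rewrite /deterministic; elim: (rules M) => //= r rs IH /andP[gr /IH ->].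
  by rewrite /applies gr.
case E: (ohead _) => [r|] // [<-]; exists r; split=> //.
- have /andP[/andP[/eqP <- _]] := ohead_filter_all (all_leq_sumn (@src k) (rules M)) E.
  by move=> le_r; rewrite /max_idx add2n addSn addSn ltnS (leq_trans le_r) //
             leqW // leq_addl.
- have /andP[_ le_r] := ohead_filter_all (all_leq_sumn symbols (rules M)) E.
  apply: sub_all (all_leq_sumn fst (acts r)) => a le_a.
  rewrite /max_sym !addSn ltnS; do 5 apply: leqW.
  by rewrite (leq_trans le_a) // (leq_trans le_r) // leq_addl.
Qed.

(** Induction on the fuel: the player makes one step for each step of [M]. *)
Lemma sim_run coins fuel n n' (c c' : config k) t0 d e p ms : deterministic M ->
  tapes c = t0 :: ms :> seq tape -> compute coins fuel n c = Some (n', c') ->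
  exists t1 ms', tapes c' = t1 :: ms' :> seq tape /\
    run (st lSim (state c)) [:: t0, d, e, p & ms]
        (st lSim q_yield) [:: t1, d, e, p & ms'].
Proof.
move=> detM; elim: fuel n c t0 ms => [|fuel IH] n c t0 ms tc /=; case: eqP => // qc.
- by move=> [_ <-]; exists t0, ms; rewrite qc; split=> //; apply: run_refl.
- by move=> [_ <-]; exists t0, ms; rewrite qc; split=> //; apply: run_refl.
case E: step => [c1|] // H.
have [r [c1E hr iN rS]] := step_table_rule detM E.
have sz : size (t0 :: ms) = k.+1 by rewrite -tc size_tuple.
have [a0 [am ar]] : exists a0 am, acts r = a0 :: am :> seq _.
  by case/tupleP: (acts r) => a0 am; exists a0, am.
have szam : size (a0 :: am) = k.+1 by rewrite -ar size_tuple.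
have tc1 : tapes c1 = act1 t0 a0 :: acts_on ms am :> seq tape.
  rewrite c1E exec_ruleE mkc_tapes tc ar //.
  by rewrite /acts_on size_map size_zip sz szam minnn.
have [t1 [ms' [tc' R]]] := IH _ _ _ _ tc1 H.
exists t1, ms'; split=> //; apply: run_trans R.
have -> : state c1 = dst r by rewrite c1E.
move: rS; rewrite ar /= => /andP[a0S amS].
rewrite -[in X in run _ _ _ X](act1_stay d) -[in X in run _ _ _ X](act1_stay e).
apply: run_step => //=.
- case: eqP => // _; move: hr; rewrite tc /= => ->.
  by congr (Some (_, _, _, _, _)); rewrite ?ar //; case/tupleP: (acts r) ar => ? ? [-> _].
- rewrite iN; case/and5P => /eqP szm t0S dS eS /andP[-> msS].
  rewrite !ok_act ?a0S ?eqxx ?orbT //= ok_acts //.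
  case: szam => szam.
  by rewrite szam szm eqxx /acts_on size_map size_zip szam szm minnn eqxx.
Qed.

(** * Reciting the list of words *)

Lemma emit_tape w l s r : exists l' s',
  emit w (Tape l s r) = Tape l' s' (map lett w ++ r).
Proof.
elim: w => [|x w [l' [s' E]]]; first by exists l, s.
by exists (behead l'), (head 0 l'); rewrite [emit _ _]/= -/(emit w _) E.
Qed.

Lemma emit_blank w r :
  emit w (Tape [::] 0 r) = Tape [::] 0 (map lett w ++ r).
Proof. by elim: w => //= x w ->. Qed.

Lemma letters_lett w s : letters (map lett w ++ 0 :: s) = w.
Proof. by elim: w => //= -[] w ->. Qed.

(** The 0 written first ends the word, hiding what the input left to its right; the last move puts
    the head back on the first letter. *)
Lemma talk_run j t0 dl dr c p ms : j < size words ->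
  exists2 t', word_of_tape t' = nth [::] words j &
    run q_active [:: t0, Tape dl (b + j) dr, c, p & ms]
        q_yield [:: t', Tape dl (b + j.+1) dr, c, p & ms].
Proof.
move=> jw; pose t1 := act1 t0 (0, Lft); pose w := nth [::] words j.
have bj : b <= b + j < b + size words by rewrite leq_addr ltn_add2l.
have [l [s E]] := emit_tape w (lhs t1) (scan t1) (rhs t1).
exists (act1 (Tape l s (map lett w ++ rhs t1)) (s, Rgt)).
  rewrite /word_of_tape /= -[RHS](letters_lett _ (rhs t0)).
  by rewrite -/w; case: (w) => [|x w'].
apply: run_trans.
  apply: (@run_keep lAct 0 t0 _ c p ms _ (0, Lft) (b + j, Stay) (scan c, Stay)) => //=.
  - by rewrite bj.
  - by rewrite !eqxx !orbT.
  - by rewrite leq_addr.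
rewrite (act1_stay c); apply: run_trans.
  exact: (@start_run lTalk).
rewrite /= addKn -/w -/t1.
have -> : emit w t1 = Tape l s (map lett w ++ rhs t1) by rewrite -E; case: (t1).
apply: (@run_keep lTalk 0 _ _ c p ms _ (s, Rgt) ((b + j).+1, Stay) (scan c, Stay)) => //=.
- move=> _; rewrite !eqxx !orbT andbT /= /max_sym.
  apply/orP; left; rewrite !addSn add0n; do 5 apply: leqW.
  by rewrite ltnS (leq_trans _ (leq_addr _ _)) // -addnS leq_add2l.
- by rewrite addnS.
- exact: act1_stay.
Qed.

Lemma ok_tape_of_word w : okt (tape_of_word w).
Proof.
have H : all (gtn max_sym) (map lett w) by rewrite all_map; apply/allP => -[].
rewrite /okt /tape_of_word /= -/(map lett w).
by case: (map lett w) H => [|x s] //= /andP[-> ->].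
Qed.

(** Inputs overwrite only the first tape, so the count on the data tape survives between
    activations. Asking only that the activated [cfg] reach the reciting configuration leaves room
    for the long first activation of the agent. *)
Lemma talk_session ins j t0 dl dr c p ms i cfg coins t :
  ok [:: t0, Tape dl (b + j) dr, c, p & ms] ->
  reach player (activate cfg i)
    (mkc k.+3 q_active [:: t0, Tape dl (b + j) dr, c, p & ms]) ->
  @session_from player coins t cfg (zip (i :: ins) (drop j words)).
Proof.
elim: ins j t0 i cfg t => [|i' ins IH] j t0 i cfg t okts R;
  (have [jw|?] := ltnP j (size words); last by rewrite drop_oversize).
all: rewrite (drop_nth [::] jw) /=.
all: have [t' t'E /(_ okts)[okts' R']] := talk_run t0 dl dr c p ms jw.
all: have [n H] := reach_trans R R'.
all: exists (n + 0), (t + n),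
  (mkc k.+3 q_yield [:: t', Tape dl (b + j.+1) dr, c, p & ms]).
all: have szms : size ms = k by case/andP: okts => /eqP.
all: split; [by rewrite H compute_yield | | ] => //.
1,3: by rewrite /output (tnth_nth blank_tape) mkc_tapes /= ?szms.
  by case: (drop _ _).
apply: (IH _ (tape_of_word i')); last by rewrite activateE /= ?szms //; apply: reach_refl.
case/and5P: okts' => /= -> _ -> -> ->; by rewrite ok_tape_of_word.
Qed.

End Player.

(** * Runs and code of the prelude *)

Lemma map_pmap (K T : Type) (f : K -> T) s : map f s = pmap (Some \o f) s.
Proof. by elim: s => //= x s ->. Qed.

Section Prelude.
Variables (M : machine) (b : nat) (words : seq word) (us : seq nat).
Hypothesis b_gt0 : 0 < b.
Local Notation k := (aux M).
Local Notation agt := (player b words (prelude M us)).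

(** Prelude rules require state 0 and a 0 on the data tape, whereas a reciting player scans at least
    [b > 0] there. *)
Lemma prelude_inert q t0 d c p ms coin : size ms = k ->
  (q != 0) || (b <= scan d) ->
  ~~ has (applies (mkc k.+3 q [:: t0, d, c, p & ms]) coin) (prelude M us).
Proof.
move=> szm hd; rewrite has_map; apply/hasPn => i _ /=.
rewrite applies_mkc /= ?szm //; case/orP: hd => [/negPf qn0|bd].
  by rewrite eq_sym qn0.
rewrite !eqseq_cons [0 == scan d]eq_sym.
case: (scan d) bd => [|x _]; last by rewrite /= !andbF.
by rewrite leqNgt b_gt0.
Qed.

Lemma prelude_step i t0 d c p ms coin : i < size us ->
  map scan [:: t0, d, c, p & ms] = [:: 0, 0, 0, i & nseq k 0] ->
  let u := nth 0 us i in
  @step agt (mkc k.+3 0 [:: t0, d, c, p & ms]) coin =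
  Some (mkc k.+3 (prule_dst u)
    [:: act1 t0 (prule_out u), act1 d (u, Rgt), act1 c (1, Rgt),
        act1 p (i.+1, prule_dir u) & acts_on ms (nseq k (0, Stay))]).
Proof.
move=> ius scE u; have szm : size ms = k.
  by case: scE => _ _ _ _ /(congr1 size); rewrite size_map size_nseq.
rewrite /step /= filter_cat /prelude /mkseq map_pmap.
pose f j := prule M j (nth 0 us j).
have E : ohead (seq.filter (applies (mkc k.+3 0 [:: t0, d, c, p & ms]) coin)
    (pmap (Some \o f) (iota 0 (size us)))) = Some (f i).
  apply: (@ohead_filter_pmap _ _ (Some \o f)) => [|j r [<-]].
    by rewrite mem_iota.
  rewrite applies_mkc /= ?szm //; case: scE => -> -> -> -> ->.
  by rewrite !eqseq_cons !eqxx /= andbT.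
case: (seq.filter _ _) E => //= r rs [->].
by rewrite exec_rule_mkc //= szm.
Qed.

End Prelude.

Lemma acts_on_blank n :
  acts_on (nseq n blank_tape) (nseq n (0, Stay)) = nseq n blank_tape.
Proof. by elim: n => //= n IH; exact: (congr1 (cons _) IH). Qed.

Lemma prelude_run M b words (v : word) : 0 < b ->
  let vs := map lett v in let us := rcons vs 3 in
  reach (player b words (prelude M us))
    (mkc (aux M).+3 q_active (nseq (aux M).+4 blank_tape))
    (mkc (aux M).+3 (st lNext 0)
      [:: Tape [::] 0 (rev vs), Tape (rev us) 0 [::],
          Tape (nseq (size us) 1) 0 [::], Tape [:: (size us)] 0 [::]
        & nseq (aux M) blank_tape]).
Proof.
move=> b0 vs us; set A := player _ _ _.
(* Invariant after [i] letters; moving leftwards lays them out in reverse order on the output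
   tape. *)
have H i : i <= size vs -> reach A
    (mkc (aux M).+3 q_active (nseq (aux M).+4 blank_tape))
    (mkc (aux M).+3 q_active
      [:: Tape [::] 0 (rev (take i vs)), Tape (rev (take i vs)) 0 [::],
          Tape (nseq i 1) 0 [::], Tape [::] i [::]
        & nseq (aux M) blank_tape]).
  elim: i => [_|i IH ivs]; first by rewrite take0; apply: reach_refl.
  apply: (reach_trans (IH (ltnW ivs))); apply: reach_step => // coin.
  have ius : i < size us by rewrite size_rcons ltnS ltnW.
  rewrite (@prelude_step _ _ _ _ i) //; last by rewrite /= map_nseq.
  rewrite acts_on_blank /us nth_rcons ivs.
  have u3 : nth 0 vs i == 3 = false.
    by have /mapP[[] _ ->] := mem_nth 0 ivs.
  by rewrite (take_nth 0 ivs) rev_rcons /prule_dst /prule_out /prule_dir u3.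
apply: (reach_trans (H _ (leqnn _))); apply: reach_step => // coin.
rewrite take_size (@prelude_step _ _ _ _ (size vs)) ?[size us]size_rcons //; last first.
  by rewrite /= map_nseq.
rewrite /us nth_rcons ltnn eqxx.
by rewrite acts_on_blank rev_rcons.
Qed.

Lemma code_prelude M us :
  flatten [seq true :: enc_rule r | r <- prelude M us] = code M (rev us).
Proof.
elim/last_ind: us => // us u IH; rewrite rev_rcons /= size_rev.
rewrite /prelude size_rcons /mkseq -[(size us).+1]addn1 iotaD !map_cat flatten_cat.
rewrite [flatten [seq _ | i <- map _ (iota _ 1)]]/=.
rewrite nth_rcons ltnn eqxx cats0 enc_prule -IH; congr (flatten (map _ _) ++ _).
by apply/eq_in_map => i; rewrite mem_iota nth_rcons => /andP[_ ->].
Qed.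

(** * The diagonal agent *)

Definition tail_code (M : machine) (words : seq word) (E : machine) : word :=
  flatten [seq true :: enc_rule r | r <- body M 4 words] ++ [:: false] ++
  enc_machine E.

(** The word is reversed because the prelude writes it leftwards; 3 is the end mark. *)
Definition diag_prelude M words E : seq (rule (aux M).+3) :=
  prelude M (rcons (map lett (rev (tail_code M words E))) 3).

(** The base 4 lies above the blank, the two letters and the end mark. *)
Definition diag_agent (M : machine) (words : seq word) (E : machine) : machine :=
  player 4 words (diag_prelude M words E).

Section Diagonal.
Variables (M : machine) (words : seq word) (E : machine).
Local Notation k := (aux M).
Local Notation D := (diag_agent M words E).
Local Notation pair_code := (enc_pair D E).

Lemma diag_inert q t0 d c p ms coin : size ms = k ->
  (q != 0) || (4 <= scan d) ->
  ~~ has (applies (mkc k.+3 q [:: t0, d, c, p & ms]) coin) (diag_prelude M words E).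
Proof. exact: prelude_inert. Qed.

Lemma diag_start : exists d c p,
  [/\ scan d = 0, ok M 4 words [:: tape_of_word pair_code, d, c, p & nseq k blank_tape]
    & reach D (activate (blank_config k.+3) [::])
       (mkc k.+3 (st lSim 0)
         [:: tape_of_word pair_code, d, c, p & nseq k blank_tape])].
Proof.
pose v := rev (tail_code M words E).
have := @prelude_run M 4 words v isT.
set vs := map lett v; set us := rcons vs 3 => R.
have usP : all (fun u => u != 0) (rev us).
  by rewrite all_rev all_rcons /= all_map; apply/allP => -[].
have [d [c [d0 H]]] := @loop_run M 4 words _ diag_inert (rev us) [::]
  (Tape [::] 0 (rev vs)) 0 [::] [::] (Tape [:: size us] 0 [::])
  (nseq k blank_tape) usP erefl.
exists d, c, (Tape [:: size us] 0 [::]).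
have tE : write_tape (emit (behead (enc_nat k.+3) ++ code M (rev us))
   (Tape [::] 0 (rev vs))) 2 = tape_of_word pair_code.
  (* The self-reference closes here: [rev v] is the tail copied by the prelude, and everything
     before it has been recomputed from that copy. *)
  have -> : pair_code = true :: behead (enc_nat k.+3) ++ code M (rev us) ++ rev v.
    rewrite -code_prelude revK /enc_pair /enc_machine /enc_rules [aux D]/= [rules D]/=.
    by rewrite map_cat flatten_cat /tail_code -!catA.
  by rewrite -map_rev emit_blank -map_cat /tape_of_word /= !catA.
rewrite tE size_rev cats0 in H.
have /H[okts R'] : ok M 4 words [:: Tape [::] 0 (rev vs), Tape (rev us) 0 [::],
    Tape (nseq (size us) 1) 0 [::], Tape [:: size us] 0 [::] & nseq k blank_tape].
  apply/and5P; split; rewrite ?size_nseq //.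
  - by rewrite /okt /= all_rev all_map; apply/allP => -[].
  - by rewrite /okt /= cats0 all_rev all_rcons /= all_map; apply/allP => -[].
  - by rewrite /okt /= cats0 all_nseq orbT.
  - by rewrite /= all_nseq orbT.
split=> //; apply: reach_trans R'.
by rewrite blank_configE activateE ?size_nseq.
Qed.

Lemma diag_verdict o : deterministic M ->
  session M (fun=> false) [:: (pair_code, o)] ->
  exists t d c p ms,
    [/\ word_of_tape t = o, scan d = 0, ok M 4 words [:: t, d, c, p & ms]
      & reach D (activate (blank_config k.+3) [::])
          (mkc k.+3 (st lSim q_yield) [:: t, d, c, p & ms])].
Proof.
move=> detM [fuel [t' [c1 [H o1 _]]]].
have [d [c [p [d0 okts R]]]] := diag_start.
have tc : tapes (activate (blank_config k) pair_code) =
    tape_of_word pair_code :: nseq k blank_tape :> seq tape.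
  by rewrite blank_configE activateE ?mkc_tapes /= ?size_nseq.
have [t1 [ms [tc1 /(_ okts)[okts' R']]]] :=
  sim_run (b := 4) words diag_inert d c p detM tc H.
exists t1, d, c, p, ms; split=> //; last exact: reach_trans R R'.
by rewrite -o1 /output (tnth_nth blank_tape) tc1.
Qed.

Lemma diag_stuck coins fuel t : deterministic M ->
  session M (fun=> false) [:: (pair_code, [:: true])] ->
  @compute D coins fuel t (activate (blank_config k.+3) [::]) = None.
Proof.
move=> detM /(diag_verdict detM)[t1 [d [c [p [ms [t1E d0 okts R]]]]]].
apply: (stuck_never_yields _ _ _ R) => // x.
(* The verdict true leaves 2 under the head, for which [lSim] has no transition in the yield state
   of [M]. *)
rewrite (player_step diag_inert) //=.
by case: t1 t1E {okts R} => l [|[|s]].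
Qed.

Lemma diag_talks coins ins : deterministic M ->
  session M (fun=> false) [:: (pair_code, [:: false])] ->
  session D coins (zip ([::] :: ins) words).
Proof.
move=> detM /(diag_verdict detM)[t1 [d [c [p [ms [t1E d0 okts R]]]]]].
have t1s : scan t1 == 1 by case: t1 t1E {okts R} => l [|[|[|s]]].
rewrite /session -[words in zip _ words]drop0.
case: d d0 okts R => dl x dr /= -> okts R.
(* On the verdict false, one step writes 4 on the data tape, which stands for no word recited so
   far. *)
have [okts' R'] : ok M 4 words [:: t1, Tape dl (4 + 0) dr, c, p & ms] /\
    reach D (mkc k.+3 (st lSim q_yield) [:: t1, Tape dl 0 dr, c, p & ms])
            (mkc k.+3 q_active [:: t1, Tape dl (4 + 0) dr, c, p & ms]).
  apply: (run_keep diag_inert (a0 := (scan t1, Stay)) (ad := (4, Stay))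
            (ac := (scan c, Stay))) okts => //=; rewrite ?act1_stay ?t1s //.
  by rewrite !eqxx !orbT.
exact: (talk_session diag_inert) okts' (reach_trans R R').
Qed.

End Diagonal.

(** * The reciting environment and the contradiction *)

(** With base 0 a blank data tape already counts no word recited, so recitation starts at the first
    activation. *)
Lemma script_talks M words coins ins :
  session (player (M := M) 0 words [::]) coins (zip ins words).
Proof.
case: ins => [|i ins]; first by case: words.
rewrite /session -[words in zip _ words]drop0.
apply: (@talk_session M 0 words [::] _ ins 0 (tape_of_word i) [::] [::]
  blank_tape blank_tape (nseq (aux M) blank_tape)) => //.
- rewrite /ok size_nseq eqxx ok_tape_of_word /= all_nseq.
  by rewrite orbT.
- by rewrite blank_configE activateE ?size_nseq //; apply: reach_refl.
Qed.

Lemma Pr_set0 (R : realType) : Pr (set0 : set R) = 0%E.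
Proof. by rewrite /Pr set0I measure0. Qed.

Lemma Pr_setT (R : realType) : Pr (setT : set R) = 1%E.
Proof. by rewrite /Pr setTI lebesgue_measure_itv /= lte01 sube0. Qed.

Theorem proposition4 (R : realType) (G : game R) (B : behavior G)
    (hB : catastrophic B) :
  ~ exists M : machine, decides M (EVERBAD B).
Proof.
move=> [M [detM decM]].
(* A behavior that never holds would be triggered with probability 0, but a catastrophic one can
   occur. *)
have [h [m Bhm]] : exists h m, B h m.
  have [[A [E [_ Pr_gt0]]] _] := hB.
  apply: contrapT => noB; move: Pr_gt0.
  rewrite (_ : ever_triggers A E B = set0) ?Pr_set0 ?ltxx //.
  by apply/seteqP; split=> // x [h [m [_ Bhm]]]; apply: noB; exists h, m.
pose moves := [seq move_word m | m <- rcons (map fst h) m].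
pose E := player (M := M) 0 (map snd h) [::].
pose A := diag_agent M moves E.
have [w Mw] := decM (enc_pair A E).
case=> [] [bad wE]; rewrite {}wE in Mw.
  (* Injectivity of the encoding makes membership a statement about this very [A] and [E]. *)
  have [A' [E' [/enc_pair_inj[<- <-]]]] := bad.
  rewrite (_ : ever_triggers A E B = set0) ?Pr_set0 ?ltxx //.
  apply/seteqP; split=> // x [h' [m' [[_ +] _]]].
  (* Any occurrence of [B] needs a move of [A], hence a first activation that yields. *)
  case: h' => [|r h'] /= [fuel [t [c [+ _ _]]]];
    by rewrite diag_stuck.
(* On the verdict false the two recitations produce [h] and then [m] for every [x], so the event has
   probability 1. *)
apply: bad; exists A, E; split=> //.
rewrite (_ : ever_triggers A E B = setT) ?Pr_setT //.
apply/seteqP; split=> // x _; exists h, m; split=> //; split.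
- rewrite /env_plays /=.
  have -> : [seq (move_word r.1, r.2) | r <- h] =
      zip [seq move_word r.1 | r <- h] (map snd h).
    by elim: (h) => //= r h' ->.
  exact: script_talks.
- exact: diag_talks.
Qed.
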